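(* If $R\le\inf_{\lambda\in\Delta_{M(R)}}L\big(\sum_{(i,j)\in M(R)}\lambda_{ij}\tilde\beta_{ij}\big)$ (with the convention that the infimum over an empty index set is $+\infty$), then $\hat S$ is a B-set for the approachability problem with action sets $U=\Delta_K$, $V=(\Delta_{\mathcal X})^K$ and vector payoff $f(w,Q)=\big(\sum_{a}w(a)D(Q_a\|\nu^i_a)\big)_{i\in[m]}$; that is, for every $y\in\mathbb R^m\setminus\hat S$, with $\pi(y)$ its Euclidean projection onto $\hat S$, there exists $w\in\Delta_K$ such that $\langle y-\pi(y),f(w,Q)-\pi(y)\rangle\le0$ for all $Q\in(\Delta_{\mathcal X})^K$.
   Context: $\mathcal X$ finite, $\Delta_{\mathcal X}$ the distributions on $\mathcal X$, $\Delta_K,\Delta_m$ the probability simplices on $[K]$, $[m]$, $D$ the KL divergence; $m\ge2$ bandits $\nu^1,\dots,\nu^m$, $\nu^i=(\nu^i_a)_{a\in[K]}$, with all $\nu^i_a(x)>0$. For $\beta\in\Delta_m$ and $a\in[K]$ let $\phi_a(\beta)=-\log\sum_{x\in\mathcal X}\prod_{i=1}^m\nu^i_a(x)^{\beta_i}$, $I(\beta)=\min_a\phi_a(\beta)$, $L(\beta)=\max_a\phi_a(\beta)$. For $1\le i<j\le m$ and $b\in[0,1]$ let $\beta_{ij}(b)=b\,e_i+(1-b)e_j\in\Delta_m$. Given $R\in\mathbb R$, let $M(R)=\{(i,j):i<j,\ \sup_{b\in[0,1]}I(\beta_{ij}(b))<R\}$, and for each $(i,j)\in M(R)$ fix a point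 $\tilde\beta_{ij}=\beta_{ij}(b_{ij})$ for some $b_{ij}\in[0,1]$. Define $I'(\beta)=R$ if $\beta=\tilde\beta_{ij}$ for some $(i,j)\in M(R)$, and $I'(\beta)=I(\beta)$ otherwise; let $I'_{concave}$ be the upper concave envelope of $I'$ on $\Delta_m$ (the smallest concave function on $\Delta_m$ dominating $I'$ pointwise). Let $\hat S=\{x\in\mathbb R^m:\langle\beta,x\rangle\ge I'_{concave}(\beta)\ \forall\beta\in\Delta_m\}$. $\Delta_{M(R)}$ is the simplex of weights $\lambda=(\lambda_{ij})_{(i,j)\in M(R)}$. *)

(* Defs.v *)
From HB Require Import structures.
From mathcomp Require Import all_boot all_order all_algebra.
From mathcomp Require Import all_classical all_reals all_analysis.
Set Implicit Arguments. Unset Strict Implicit. Unset Printing Implicit Defensive.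
Import Order.TTheory GRing.Theory Num.Theory.
Local Open Scope classical_set_scope.
Local Open Scope ring_scope.

Section Defs.
Variable R : realType.

Definition simplex (n : nat) : set ('I_n -> R) :=
  [set b | (forall i, 0 <= b i) /\ \sum_(i < n) b i = 1].
Arguments simplex : clear implicits.

Definition distr_on (X : finType) : set (X -> R) :=
  [set P | (forall x, 0 <= P x) /\ \sum_(x : X) P x = 1].

Definition KL (X : finType) (P Q : X -> R) : R :=
  \sum_(x : X) (if P x == 0 then 0 else P x * ln (P x / Q x)).

Definition dotp (m : nat) (x y : 'I_m -> R) : R := \sum_(i < m) x i * y i.

Variables (X : finType) (m K : nat) (nu : 'I_m -> 'I_K -> X -> R).

Definition phi (a : 'I_K) (beta : 'I_m -> R) : R :=
  - ln (\sum_(x : X) \prod_(i < m) powR (nu i a x) (beta i)).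

Definition Iminphi (beta : 'I_m -> R) : R := inf (range (fun a => phi a beta)).
Definition Lmaxphi (beta : 'I_m -> R) : R := sup (range (fun a => phi a beta)).

Definition beta_ij (i j : 'I_m) (b : R) : 'I_m -> R :=
  fun k => b * (k == i)%:R + (1 - b) * (k == j)%:R.

Definition inM (r : R) (i j : 'I_m) : Prop :=
  (i < j)%N /\ sup [set Iminphi (beta_ij i j b) | b in `[0, 1]] < r.

(* tilde beta_ij = beta_ij(bt i j) *)
Definition Iprime (r : R) (bt : 'I_m -> 'I_m -> R) (beta : 'I_m -> R) : R :=
  if `[< exists i j, inM r i j /\ beta = beta_ij i j (bt i j) >] then r
  else Iminphi beta.

Definition concave_on (n : nat) (g : ('I_n -> R) -> R) : Prop :=
  forall x y, simplex n x -> simplex n y -> forall t, 0 <= t <= 1 ->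
    t * g x + (1 - t) * g y <= g (fun k => t * x k + (1 - t) * y k).

Definition concave_envelope (n : nat) (F : ('I_n -> R) -> R)
    (beta : 'I_n -> R) : R :=
  inf [set g beta | g in [set g | concave_on g /\
                                  forall b, simplex n b -> F b <= g b]].

Definition Shat (r : R) (bt : 'I_m -> 'I_m -> R) : set ('I_m -> R) :=
  [set x | forall beta, simplex m beta ->
             concave_envelope (Iprime r bt) beta <= dotp beta x].

Definition payoff (w : 'I_K -> R) (Q : 'I_K -> X -> R) : 'I_m -> R :=
  fun i => \sum_(a < K) w a * KL (Q a) (nu i a).

End Defs.
Arguments simplex {R} n.

Definition is_proj (R : realType) (n : nat) (S : set ('I_n -> R))
    (y p : 'I_n -> R) : Prop :=
  S p /\ forall z, S z ->
    dotp (fun k => y k - p k) (fun k => y k - p k)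
      <= dotp (fun k => y k - z k) (fun k => y k - z k).

(* Main.v *)
(* The projection direction is [-beta] for some [beta] in the simplex, and [p]
   minimises [<beta, .>] over [Shat].  By convex duality [<beta, p>] is then (a
   limit of) a convex combination [sum_k t_k I'(b_k)] with [sum_k t_k b_k = beta].
   The raised points of this combination have a barycentre [gamma] at which
   some arm satisfies [phi_a gamma >= r]; at the other points [I <= phi_a].
   Since [phi_a b <= sum_i b_i D(Q_a || nu^i_a)], the right-hand side being
   linear in [b], playing the arm [a] keeps [<beta, f(a, Q)> >= <beta, p>]
   whatever [Q] is. *)

Require Import Defs.
From HB Require Import structures.
From mathcomp Require Import all_boot all_order all_algebra.
From mathcomp Require Import all_classical all_reals all_analysis.
From mathcomp Require Import ring lra.
Set Implicit Arguments. Unset Strict Implicit. Unset Printing Implicit Defensive.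
Import Order.TTheory GRing.Theory Num.Theory.
Local Open Scope classical_set_scope.
Local Open Scope ring_scope.

(** * Bilinearity of the pairing *)

Section Dotp.
Context {R : realType} {m : nat}.
Implicit Types (a b c : R) (x y z : 'I_m -> R).

Lemma dotpC x y : dotp x y = dotp y x.
Proof. by apply: eq_bigr => k _; rewrite mulrC. Qed.

Lemma dotpPl a b x y z :
  dotp (fun k => a * x k + b * y k) z = a * dotp x z + b * dotp y z.
Proof. by rewrite /dotp !mulr_sumr -big_split; apply: eq_bigr => k _ /=; ring. Qed.

Lemma dotpDl x y z : dotp (fun k => x k + y k) z = dotp x z + dotp y z.
Proof. by rewrite /dotp -big_split; apply: eq_bigr => k _ /=; ring. Qed.

Lemma dotpBl x y z : dotp (fun k => x k - y k) z = dotp x z - dotp y z.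
Proof. by rewrite /dotp -sumrB; apply: eq_bigr => k _ /=; ring. Qed.

Lemma dotpZl c x z : dotp (fun k => c * x k) z = c * dotp x z.
Proof. by rewrite /dotp mulr_sumr; apply: eq_bigr => k _ /=; ring. Qed.

Lemma dotpDr x y z : dotp z (fun k => x k + y k) = dotp z x + dotp z y.
Proof. by rewrite !(dotpC z) dotpDl. Qed.

Lemma dotpBr x y z : dotp z (fun k => x k - y k) = dotp z x - dotp z y.
Proof. by rewrite !(dotpC z) dotpBl. Qed.

Lemma dotpPr a b x y z :
  dotp z (fun k => a * x k + b * y k) = a * dotp z x + b * dotp z y.
Proof. by rewrite !(dotpC z) dotpPl. Qed.

Lemma dotp_cst x c : dotp x (fun=> c) = c * \sum_k x k.
Proof. by rewrite /dotp mulr_sumr; apply: eq_bigr => k _; rewrite mulrC. Qed.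

Lemma dotp_delta x (i : 'I_m) : dotp x (fun k => (k == i)%:R) = x i.
Proof.
rewrite /dotp (bigD1 i) //= eqxx mulr1 big1 ?addr0 // => k /negbTE ->.
by rewrite mulr0.
Qed.

Lemma dotpxx_ge0 x : 0 <= dotp x x.
Proof. by apply: sumr_ge0 => k _; rewrite -expr2 sqr_ge0. Qed.

Lemma dotp_young (s : R) x y : 0 < s ->
  2 * dotp x y <= s^-1 * dotp x x + s * dotp y y.
Proof.
move=> s0; rewrite /dotp !mulr_sumr -big_split /=; apply: ler_sum => k _.
have -> : s^-1 * (x k * x k) + s * (y k * y k) =
          s^-1 * (x k - s * y k) ^+ 2 + 2 * (x k * y k) by field; lra.
by rewrite lerDr mulr_ge0 ?sqr_ge0// invr_ge0 ltW.
Qed.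

End Dotp.

(** * The simplex and almost minimal majorants *)

Lemma simplex_le1 {R : realType} (n : nat) (u : 'I_n -> R) k :
  simplex n u -> u k <= 1.
Proof.
move=> [u0 <-]; rewrite (bigD1 k) //= lerDl; exact: sumr_ge0.
Qed.

Lemma simplex_dist_le {R : realType} (n : nat) (u v : 'I_n -> R) :
  simplex n u -> simplex n v ->
  dotp (fun k => u k - v k) (fun k => u k - v k) <= n%:R.
Proof.
move=> su sv; rewrite -[n in leRHS]card_ord -sumr_const; apply: ler_sum => k _.
have := simplex_le1 k su; have := simplex_le1 k sv.
have := su.1 k; have := sv.1 k; nra.
Qed.

Lemma simplex_conv {R : realType} (n : nat) (u v : 'I_n -> R) t :
  0 <= t <= 1 -> simplex n u -> simplex n v ->
  simplex n (fun k => t * u k + (1 - t) * v k).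
Proof.
move=> /andP[t0 t1] [u0 su] [v0 sv]; split=> [k|].
  by rewrite addr_ge0 ?mulr_ge0 ?subr_ge0.
by rewrite big_split -!mulr_sumr /= su sv; ring.
Qed.

(* If [p] minimises [<beta, .>] among the linear functionals dominating [G],
   then [(beta, <beta, p>)] lies in the closure of [G]: an almost minimiser
   [(u0, v0)] of [|u - beta|^2 / 2 + (<u, p> - v)] yields, through its
   first-order condition, the dominating functional
   [p + (u0 - beta) - const], which would otherwise beat [p] at [beta]. *)
Lemma minimal_majorant_adherent {R : realType} (m : nat)
    (G : ('I_m -> R) -> R -> Prop) (beta p : 'I_m -> R)
    (G0 : exists u v, G u v)
    (Gsimplex : forall u v, G u v -> simplex m u)
    (Gconv : forall (t : R) u1 v1 u2 v2, 0 <= t <= 1 -> G u1 v1 -> G u2 v2 ->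
      G (fun k => t * u1 k + (1 - t) * u2 k) (t * v1 + (1 - t) * v2))
    (beta1 : \sum_k beta k = 1)
    (Gp : forall u v, G u v -> v <= dotp u p)
    (pmin : forall z, (forall u v, G u v -> v <= dotp u z) ->
      dotp beta p <= dotp beta z) (e : R) : 0 < e <= 1 ->
  exists u v, G u v /\
    dotp (fun k => u k - beta k) (fun k => u k - beta k) + (dotp u p - v) <= e.
Proof.
move=> /andP[e0 e1].
pose J (u : 'I_m -> R) (v : R) :=
  2^-1 * dotp (fun k => u k - beta k) (fun k => u k - beta k) + (dotp u p - v).
pose E := [set j : R | exists u v, G u v /\ j = J u v].
have J0 u v : G u v -> 0 <= J u v.
  move=> /Gp guv; rewrite /J.
  by have := dotpxx_ge0 (fun k => u k - beta k); lra.
have Elb : has_lbound E by exists 0 => _ [u [v [guv ->]]]; exact: J0.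
have infE : has_inf E.
  by split=> //; have [u [v guv]] := G0; exists (J u v); exists u, v.
have m0 : 0 <= m%:R :> R by rewrite ler0n.
(* Step length for the first-order condition: [(u0, v0)] minimises [J] up to [t * t], so division by
   [t] leaves an error of at most [t + t * m / 2], hence at most [e]. *)
pose t : R := e / (1 + m%:R).
have te : t * (1 + m%:R) = e by rewrite /t divfK//; lra.
have t0 : 0 < t by rewrite divr_gt0//; lra.
have t1 : t <= 1 by nra.
have [_ [u0 [v0 [guv0 ->]]] Jlt] := inf_adherent (mulr_gt0 t0 t0) infE.
have su0 := Gsimplex _ _ guv0.
exists u0, v0; split=> //.
pose d k := u0 k - beta k.
pose V0 := dotp u0 p - v0.
have foc u v : G u v ->
    - e <= dotp u d - dotp u0 d + (dotp u p - v) - V0.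
  move=> guv; have su := Gsimplex _ _ guv.
  have t01 : 0 <= t <= 1 by rewrite (ltW t0) t1.
  have Jt : inf E <= J (fun k => t * u k + (1 - t) * u0 k) (t * v + (1 - t) * v0).
    by apply: ge_inf => //; do 2 eexists; split; [exact: Gconv t01 guv guv0|].
  have := simplex_dist_le su su0.
  move: Jt; rewrite -(lerD2r (t * t)) => /(lt_le_trans Jlt).
  rewrite /J /V0 /d !(dotpBl, dotpBr, dotpPl, dotpPr).
  rewrite !(dotpC beta) (dotpC u0 u).
  move: te t0; clear.
  set uu := dotp u u; set uu0 := dotp u u0; set u00 := dotp u0 u0.
  set ub := dotp u beta; set u0b := dotp u0 beta; set up := dotp u p.
  set u0p := dotp u0 p; set bb := dotp beta beta.
  move=> te t0 H D.
  have : t * (- t) <= t * (uu0 - ub - (u00 - u0b) + (up - v) - (u0p - v0)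
             + t * (2^-1 * m%:R)).
    have : t * t * (uu - uu0 - (uu0 - u00)) <= t * t * m%:R.
      by rewrite ler_wpM2l// mulr_ge0// ltW.
    by lra.
  rewrite ler_pM2l // -te => H2.
  have : 0 <= t * m%:R by rewrite mulr_ge0 ?ler0n// ltW.
  lra.
(* Coordinates on the simplex sum to one, so subtracting [c] from every coordinate lowers the
   pairing by [c]; [foc] then says that [p + d - c] dominates [G]. *)
pose c := dotp u0 d + V0 - e.
have zG : dotp beta p <= dotp beta (fun k => (p k + d k) - c).
  apply: pmin => u v guv; rewrite dotpBr dotpDr dotp_cst (Gsimplex _ _ guv).2.
  by have := foc _ _ guv; rewrite /c; lra.
move: zG; rewrite dotpBr dotpDr dotp_cst beta1 /c -/V0.
rewrite /d !(dotpBl, dotpBr); lra.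
Qed.

(** * Inequalities for entropies, finite families and projections *)

Lemma ln_le_subr1 {R : realType} (x : R) : 0 < x -> ln x <= x - 1.
Proof.
by move=> x0; have := @le_ln1Dx R (x - 1); rewrite subrKC; apply; lra.
Qed.

Lemma ln_prod {R : realType} (I : finType) (F : I -> R) :
  (forall i, 0 < F i) -> ln (\prod_i F i) = \sum_i ln (F i).
Proof.
move=> F0; have [//] : 0 < \prod_i F i /\ ln (\prod_i F i) = \sum_i ln (F i).
apply: (big_rec2 (fun x y => 0 < x /\ ln x = y)) => [|i x y _ [x0 <-]].
  by rewrite ln1.
by rewrite mulr_gt0// lnM ?posrE.
Qed.

(** Gibbs variational principle: with [g] the geometric mixture and [Z] its mass, the right side is
    [KL Q (g / Z) - ln Z], and this divergence is nonnegative by [ln x <= x - 1]. *)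
Lemma phi_le_KL {R : realType} (X : finType) (m K : nat)
    (nu : 'I_m -> 'I_K -> X -> R) (a : 'I_K) (beta : 'I_m -> R) (Q : X -> R) :
  (forall i x, 0 < nu i a x) -> simplex m beta -> distr_on Q ->
  phi nu a beta <= dotp beta (fun i => KL Q (nu i a)).
Proof.
move=> nu0 [b0 b1] [Q0 Q1]; rewrite /phi.
pose g x := \prod_(i < m) powR (nu i a x) (beta i).
have g0 x : 0 < g x by apply: prodr_gt0 => i _; rewrite powR_gt0.
have lng x : ln (g x) = \sum_i beta i * ln (nu i a x).
  rewrite ln_prod => [|i]; last by rewrite powR_gt0.
  by apply: eq_bigr => i _; rewrite ln_powR.
set Z := \sum_x g x.
have Z0 : 0 < Z.
  have [x _|] := pickP X.
    by rewrite /Z (bigD1 x) //= ltr_pwDl// sumr_ge0// => y _; rewrite ltW.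
  move=> X0; move/eqP: Q1; rewrite big1 ?(eq_sym 0) ?oner_eq0// => x.
  by have := X0 x.
have -> : dotp beta (fun i => KL Q (nu i a)) =
    \sum_x (if Q x == 0 then 0 else Q x * (ln (Q x) - ln (g x))).
  rewrite /dotp /KL; under eq_bigr do rewrite mulr_sumr.
  rewrite exchange_big; apply: eq_bigr => x _ /=.
  case: eqP => [_|/eqP Qx]; first by rewrite big1 // => i _; rewrite mulr0.
  have Qp : 0 < Q x by rewrite lt_neqAle eq_sym Qx Q0.
  under eq_bigr do rewrite ln_div ?posrE// mulrBr mulrBr.
  rewrite sumrB -mulr_suml b1 mul1r lng mulrBr mulr_sumr; congr (_ - _).
  by apply: eq_bigr => i _; ring.
have : \sum_x (Q x - g x / Z - Q x * ln Z) <=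
    \sum_x (if Q x == 0 then 0 else Q x * (ln (Q x) - ln (g x))).
  apply: ler_sum => x _; case: eqP => [->|/eqP Qx].
    by have := divr_ge0 (ltW (g0 x)) (ltW Z0); lra.
  have Qp : 0 < Q x by rewrite lt_neqAle eq_sym Qx Q0.
  have gZQ0 : 0 < g x / Z / Q x by rewrite !divr_gt0.
  have := ler_wpM2l (ltW Qp) (ln_le_subr1 gZQ0).
  have -> : Q x * (g x / Z / Q x - 1) = g x / Z - Q x.
    by field; rewrite Qx gt_eqF.
  rewrite !ln_div ?posrE ?divr_gt0//; lra.
rewrite !sumrB -!mulr_suml Q1 -/Z divff ?gt_eqF//; lra.
Qed.

(** Otherwise, [I] being finite, one margin works for the failure of all [h a] at [beta]. Points of
    [G] come arbitrarily close to [(beta, <beta, p>)], and each is dominated by some [h a], which is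
    a contradiction. *)
Lemma finite_family_majorant {R : realType} (m : nat) (I : finType)
    (G : ('I_m -> R) -> R -> Prop) (beta p : 'I_m -> R)
    (G0 : exists u v, G u v)
    (Gsimplex : forall u v, G u v -> simplex m u)
    (Gconv : forall (t : R) u1 v1 u2 v2, 0 <= t <= 1 -> G u1 v1 -> G u2 v2 ->
      G (fun k => t * u1 k + (1 - t) * u2 k) (t * v1 + (1 - t) * v2))
    (beta1 : \sum_k beta k = 1)
    (Gp : forall u v, G u v -> v <= dotp u p)
    (pmin : forall z, (forall u v, G u v -> v <= dotp u z) ->
      dotp beta p <= dotp beta z)
    (h : I -> 'I_m -> R)
    (Gh : forall u v, G u v -> exists a, v <= dotp u (h a)) :
  exists a, dotp beta p <= dotp beta (h a).
Proof.
apply: contrapT => /forallNP Nh.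
pose gap a := dotp beta p - dotp beta (h a).
have gap0 a : 0 < gap a by rewrite subr_gt0 ltNge; apply/negP/Nh.
pose kk a := dotp (fun i => p i - h a i) (fun i => p i - h a i).
have kk0 a : 0 <= kk a by exact: dotpxx_ge0.
(* Chosen so that accuracy [s * s] suffices: Young's inequality with parameter [s] and
   [v <= <u, h a>] give [2 * gap a <= s * (1 + kk a) + 2 * s * s], which is at most
   [s * (3 + kk a)], hence at most [gap a]. The default 1 ensures [s <= 1]. *)
pose s : R := \big[Num.min/1]_a (gap a / (3 + kk a)).
have s0 : 0 < s.
  by apply/bigmin_gtP; split=> // a _; rewrite divr_gt0//; have := kk0 a; lra.
have s1 : s <= 1 by exact: bigmin_le_id.
have sa a : s * (3 + kk a) <= gap a.
  rewrite -ler_pdivlMr; first exact: bigmin_le.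
  by have := kk0 a; lra.
have e01 : 0 < s * s <= 1 by apply/andP; split; nra.
have [u [v [guv uv_le]]] :=
  minimal_majorant_adherent G0 Gsimplex Gconv beta1 Gp pmin e01.
have [a va] := Gh _ _ guv.
have Gpuv := Gp _ _ guv.
pose d i := u i - beta i.
have d0 := dotpxx_ge0 d.
have := @dotp_young _ _ s (fun i => beta i - u i) (fun i => p i - h a i) s0.
have -> : dotp (fun i => beta i - u i) (fun i => beta i - u i) = dotp d d.
  by apply: eq_bigr => i _; rewrite /d; ring.
have : s^-1 * dotp d d <= s.
  by rewrite mulrC ler_pdivrMr//; move: uv_le; rewrite -/d; lra.
have := sa a; have := s0; have := s1; have := kk0 a.
rewrite -/(kk a) /gap !(dotpBl, dotpBr).
move: uv_le va Gpuv d0; rewrite -/d; move: (kk a) (dotp d d) => k dd.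
nra.
Qed.

(** Otherwise a short move from [p] towards [z] stays in [S] and comes closer to [y]. *)
Lemma is_proj_obtuse {R : realType} (n : nat) (S : set ('I_n -> R)) y p z :
  (forall t x1 x2, 0 <= t <= 1 -> S x1 -> S x2 ->
     S (fun k => t * x1 k + (1 - t) * x2 k)) ->
  is_proj S y p -> S z ->
  dotp (fun k => y k - p k) (fun k => z k - p k) <= 0.
Proof.
move=> Sconv [Sp pmin] Sz.
set c := dotp _ _; rewrite leNgt; apply/negP => c0.
set D := dotp (fun k => z k - p k) (fun k => z k - p k).
have D0 : 0 <= D by exact: dotpxx_ge0.
(* The squared distance changes by [t * t * D - 2 * t * c], negative since [t * D <= c]. The [c] in
   the denominator gives [t <= 1] and allows [D = 0]. *)
pose t := c / (c + D).
have t0 : 0 < t by rewrite divr_gt0//; lra.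
have tcD : t * (c + D) = c by rewrite /t divfK//; lra.
have t01 : 0 <= t <= 1 by apply/andP; split; nra.
have := pmin _ (Sconv _ _ _ t01 Sz Sp).
have -> : dotp (fun k => y k - (t * z k + (1 - t) * p k))
    (fun k => y k - (t * z k + (1 - t) * p k)) =
    dotp (fun k => y k - p k) (fun k => y k - p k) - 2 * t * c + t * t * D.
  rewrite /c /D !(dotpBl, dotpBr, dotpPl, dotpPr) !(dotpC p) (dotpC z y); ring.
nra.
Qed.

(** * Concave envelopes and linear majorants *)

Section ConcaveEnvelope.
Context {R : realType} {m : nat}.
Variable F : ('I_m -> R) -> R.

(** Convex hull of the graph of [F] over the simplex, generated by binary mixtures so that induction
    needs only the graph and one mixing step. *)
Inductive conv_hull : ('I_m -> R) -> R -> Prop :=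
| conv_hull_graph b : simplex m b -> conv_hull b (F b)
| conv_hull_conv (t : R) u1 v1 u2 v2 : 0 <= t <= 1 ->
    conv_hull u1 v1 -> conv_hull u2 v2 ->
    conv_hull (fun k => t * u1 k + (1 - t) * u2 k) (t * v1 + (1 - t) * v2).

Lemma conv_hull_simplex u v : conv_hull u v -> simplex m u.
Proof. by elim=> // *; exact: simplex_conv. Qed.

Lemma conv_hull_le_dotp z :
  (forall b, simplex m b -> F b <= dotp b z) ->
  forall u v, conv_hull u v -> v <= dotp u z.
Proof.
move=> Fz u v; elim=> [b /Fz //|t u1 v1 u2 v2 /andP[t0 t1] _ h1 _ h2].
by rewrite dotpPl; apply: lerD; apply: ler_wpM2l => //; rewrite subr_ge0.
Qed.

(* Boundedness makes the set of concave majorants nonempty, so that the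
   infimum defining the envelope is not a junk value. *)
Lemma concave_envelope_le_dotpP (B : R) z :
  (forall b, simplex m b -> F b <= B) ->
  (forall b, simplex m b -> concave_envelope F b <= dotp b z) <->
  (forall b, simplex m b -> F b <= dotp b z).
Proof.
move=> FB; split=> Fz b sb.
  apply: le_trans (Fz _ sb); apply: lb_le_inf.
    exists B, (fun=> B) => //; split=> // x y _ _ t _.
    by rewrite -mulrDl subrKC mul1r.
  by move=> _ [g [_ Fg] <-]; exact: Fg.
apply: ge_inf; first by exists (F b) => _ [g [_ Fg] <-]; exact: Fg.
by exists (fun b => dotp b z) => //; split=> // x y _ _ t _; rewrite dotpPl.
Qed.

End ConcaveEnvelope.

(** * Geometry of [Shat] and choice of an arm *)

Section Bandits.
Context {R : realType} {X : finType} {m K : nat}.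
Variable nu : 'I_m -> 'I_K -> X -> R.

Lemma Iminphi_le a b : Iminphi nu b <= phi nu a b.
Proof.
apply: ge_inf; last by exists a.
case: (@arg_minP _ _ _ a predT (fun c => phi nu c b)) => // c _ hc.
by exists (phi nu c b) => _ [e _ <-]; exact: hc.
Qed.

Lemma Lmaxphi_attained b : (0 < K)%N -> exists a, Lmaxphi nu b <= phi nu a b.
Proof.
move=> K0; pose a0 := Ordinal K0.
case: (@arg_maxP _ _ _ a0 predT (fun c => phi nu c b)) => // c _ hc.
exists c; apply: ge_sup; first by exists (phi nu a0 b), a0.
by move=> _ [e _ <-]; exact: hc.
Qed.

Lemma beta_ij_simplex (i j : 'I_m) (b : R) :
  0 <= b <= 1 -> simplex m (beta_ij i j b).
Proof.
move=> /andP[b0 b1]; split=> [k|].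
  by rewrite addr_ge0 ?mulr_ge0 ?subr_ge0 ?ler0n.
have s1 (c : 'I_m) : \sum_(k < m) (k == c)%:R = 1 :> R.
  by rewrite (bigD1 c)//= eqxx big1 ?addr0// => k /negbTE ->.
by rewrite big_split -!mulr_sumr /= !s1; ring.
Qed.

Hypothesis nu_gt0 : forall i a x, 0 < nu i a x.
Hypothesis nu_sum1 : forall i a, \sum_x nu i a x = 1.
Hypothesis m_gt0 : (0 < m)%N.
Hypothesis K_gt0 : (0 < K)%N.
Variables (r : R) (bt : 'I_m -> 'I_m -> R).
Hypothesis bt01 : forall i j, inM nu r i j -> 0 <= bt i j <= 1.

(** Off the raised points, [phi_le_KL] for one fixed arm and one fixed [Q] bounds [Iprime] by a
    linear form, which is bounded on the simplex. *)
Lemma Iprime_bounded : exists B, forall b, simplex m b -> Iprime nu r bt b <= B.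
Proof.
pose a := Ordinal K_gt0; pose Q := nu (Ordinal m_gt0) a.
have dQ : distr_on Q by split=> [x|]; [exact: ltW (nu_gt0 _ _ _)|exact: nu_sum1].
exists (`|r| + \sum_i `|KL Q (nu i a)|) => b sb.
have S0 : 0 <= \sum_i `|KL Q (nu i a)| by exact: sumr_ge0.
rewrite /Iprime; case: ifP => _; first by have := ler_norm r; lra.
apply: le_trans (Iminphi_le a b) _.
apply: le_trans (phi_le_KL _ sb dQ) _ => //.
rewrite -[leLHS]add0r lerD//; apply: ler_sum => i _.
apply: le_trans (ler_norm _) _; rewrite normrM ger0_norm ?sb.1//.
by rewrite ler_piMl// simplex_le1.
Qed.

Lemma ShatP z :
  Shat nu r bt z <-> forall b, simplex m b -> Iprime nu r bt b <= dotp b z.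
Proof. by have [B hB] := Iprime_bounded; exact: concave_envelope_le_dotpP hB. Qed.

Lemma Shat_conv (t : R) x1 x2 : 0 <= t <= 1 ->
  Shat nu r bt x1 -> Shat nu r bt x2 ->
  Shat nu r bt (fun k => t * x1 k + (1 - t) * x2 k).
Proof.
move=> /andP[t0 t1] S1 S2 b sb; rewrite dotpPr.
have := S1 _ sb; have := S2 _ sb; nra.
Qed.

(** This will force [p - y] to have nonnegative coordinates. *)
Lemma Shat_upward z i :
  Shat nu r bt z -> Shat nu r bt (fun k => z k + (k == i)%:R).
Proof.
move=> Sz b sb; rewrite dotpDr dotp_delta.
by apply: le_trans (Sz _ sb) _; rewrite lerDl sb.1.
Qed.

(** Without normalisation [tot] and [mix] are linear in the weights, so raised parts of convex
    combinations simply add; division by the mass happens once, when [hcond] is applied. *)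
Let tot (lam : 'I_m -> 'I_m -> R) : R :=
  \sum_(i < m) \sum_(j < m | `[< inM nu r i j >]) lam i j.

Let mix (lam : 'I_m -> 'I_m -> R) (k : 'I_m) : R :=
  \sum_(i < m) \sum_(j < m | `[< inM nu r i j >])
    lam i j * beta_ij i j (bt i j) k.

Let weights (lam : 'I_m -> 'I_m -> R) : Prop :=
  forall i j, inM nu r i j -> 0 <= lam i j.

Lemma tot_lin s t l1 l2 :
  tot (fun i j => s * l1 i j + t * l2 i j) = s * tot l1 + t * tot l2.
Proof.
rewrite /tot !mulr_sumr -big_split; apply: eq_bigr => i _ /=.
by rewrite !mulr_sumr -big_split.
Qed.

Lemma mix_lin s t l1 l2 k :
  mix (fun i j => s * l1 i j + t * l2 i j) k = s * mix l1 k + t * mix l2 k.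
Proof.
rewrite /mix !mulr_sumr -big_split; apply: eq_bigr => i _ /=.
by rewrite !mulr_sumr -big_split; apply: eq_bigr => j _ /=; ring.
Qed.

Lemma mix_ge0 lam k : weights lam -> 0 <= mix lam k.
Proof.
move=> l0; apply: sumr_ge0 => i _; apply: sumr_ge0 => j /asboolP Mij.
by rewrite mulr_ge0 ?l0//; have [] := beta_ij_simplex i j (bt01 Mij).
Qed.

Lemma mix_sum lam : \sum_k mix lam k = tot lam.
Proof.
rewrite /mix exchange_big; apply: eq_bigr => i _ /=.
rewrite exchange_big; apply: eq_bigr => j /asboolP Mij /=.
by rewrite -mulr_sumr; have [_ ->] := beta_ij_simplex i j (bt01 Mij); rewrite mulr1.
Qed.

Lemma sum_delta2 (P : 'I_m -> 'I_m -> bool) (f : 'I_m -> 'I_m -> R) i0 j0 :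
  P i0 j0 ->
  \sum_i \sum_(j | P i j) ((i == i0) && (j == j0))%:R * f i j = f i0 j0.
Proof.
move=> P0; rewrite (bigD1 i0)//= (bigD1 j0)//= !eqxx mul1r.
rewrite !big1 ?addr0// => [i /negbTE -> |j /andP[_ /negbTE ->]].
  by rewrite big1 // => j _; rewrite mul0r.
by rewrite mul0r.
Qed.

Hypothesis hcond : forall lam, weights lam -> tot lam = 1 ->
  r <= Lmaxphi nu (mix lam).

(* The part of a convex combination carried by the raised points is paid for
   by [hcond] with a single arm [a]; on the remaining part [q], [Iminphi] is
   below the value of every arm. *)
Lemma conv_hull_Iprime_le (Q : 'I_K -> X -> R) u v :
  (forall a, distr_on (Q a)) -> conv_hull (Iprime nu r bt) u v ->
  exists a, v <= dotp u (fun i => KL (Q a) (nu i a)).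
Proof.
move=> dQ huv; pose h a i := KL (Q a) (nu i a).
have phi_h a b : simplex m b -> phi nu a b <= dotp b (h a).
  by move=> sb; apply: phi_le_KL.
(* Induction invariant: [q] and [lam] carry the ordinary and the raised parts with their masses. As
   [w] stays below [<q, h a>] for every arm, the raised part alone may choose the arm. *)
have [q [lam [w [l0 uE vle wle]]]] : exists q lam w,
    [/\ weights lam, u = (fun k => q k + mix lam k), v <= w + r * tot lam
      & forall a, w <= dotp q (h a)].
  elim: huv => [b sb|].
    rewrite /Iprime; case: asboolP => [[i0 [j0 [M0 bE]]]|_].
      exists (fun=> 0), (fun i j => ((i == i0) && (j == j0))%:R), 0.
      have M0b : `[< inM nu r i0 j0 >] by exact/asboolP.
      split=> [i j _||| a]; first exact: ler0n.
      - by apply/funext => k; rewrite bE /mix sum_delta2// add0r.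
      - have := @sum_delta2 (fun i j => `[< inM nu r i j >]) (fun _ _ => 1) _ _ M0b.
        under eq_bigr do under eq_bigr do rewrite mulr1.
        by rewrite /tot => ->; rewrite add0r mulr1.
      - by rewrite /dotp big1// => k _; rewrite mul0r.
    exists b, (fun _ _ => 0), (Iminphi nu b); split=> [//|||a].
    - apply/funext => k; rewrite /mix big1 ?addr0// => i _.
      by rewrite big1// => j _; rewrite mul0r.
    - rewrite /tot big1 ?mulr0 ?addr0// => i _; by rewrite big1.
    - exact: le_trans (Iminphi_le a b) (phi_h a b sb).
  move=> t u1 v1 u2 v2 /andP[t0 t1] _ [q1 [l1 [w1 [p1 -> h1 k1]]]].
  move=> _ [q2 [l2 [w2 [p2 -> h2 k2]]]].
  exists (fun k => t * q1 k + (1 - t) * q2 k),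
    (fun i j => t * l1 i j + (1 - t) * l2 i j), (t * w1 + (1 - t) * w2).
  split=> [i j Mij|||a].
  - by rewrite addr_ge0 ?mulr_ge0 ?p1 ?p2 ?subr_ge0.
  - by apply/funext => k; rewrite mix_lin; ring.
  - by rewrite tot_lin; nra.
  - by rewrite dotpPl; have := k1 a; have := k2 a; nra.
have tot0 : 0 <= tot lam.
  by rewrite -mix_sum sumr_ge0// => k _; exact: mix_ge0.
(* Without raised mass [u = q] and any arm serves; this covers an empty index set, where the infimum
   is [+oo] by convention. *)
have [totE|tot_neq0] := eqVneq (tot lam) 0.
  exists (Ordinal K_gt0); apply: le_trans vle _; rewrite totE mulr0 addr0.
  suff -> : u = q by exact: wle.
  apply/funext => k; rewrite uE; move: totE; rewrite -mix_sum.
  by move/psumr_eq0P => ->//; rewrite ?addr0// => i _; exact: mix_ge0.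
have tot_gt0 : 0 < tot lam by rewrite lt_neqAle eq_sym tot_neq0.
pose l' i j := (tot lam)^-1 * lam i j.
have l'0 : weights l' by move=> i j Mij; rewrite mulr_ge0 ?l0 ?invr_ge0.
have tl' : tot l' = 1.
  rewrite /tot; under eq_bigr do rewrite -mulr_sumr.
  by rewrite -mulr_sumr mulVf.
have sl' : simplex m (mix l').
  by split=> [k|]; [exact: mix_ge0|rewrite mix_sum].
have [a La] := Lmaxphi_attained (mix l') K_gt0.
exists a; have := le_trans (hcond l'0 tl') (le_trans La (phi_h a _ sl')).
have -> : mix l' = (fun k => (tot lam)^-1 * mix lam k).
  apply/funext => k; rewrite /mix mulr_sumr; apply: eq_bigr => i _.
  by rewrite mulr_sumr; apply: eq_bigr => j _; rewrite mulrA.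
rewrite dotpZl ler_pdivlMl// => rle.
by rewrite uE dotpDl -/(h a); have := wle a; lra.
Qed.

(** If each arm had a bad response [Q a], these would form a single environment, against which every
    hull point is dominated by some arm. [finite_family_majorant] then yields an arm that is good at
    [beta] against its own bad response. *)
Lemma Shat_Bset_direction (beta p : 'I_m -> R) :
  simplex m beta -> Shat nu r bt p ->
  (forall z, Shat nu r bt z -> dotp beta p <= dotp beta z) ->
  exists a, forall Q, distr_on Q ->
    dotp beta p <= dotp beta (fun i => KL Q (nu i a)).
Proof.
move=> sb Sp pmin; apply: contrapT => /forallNP N.
have /fin_all_exists[Q hQ] : forall a, exists Q, distr_on Q /\
    dotp beta (fun i => KL Q (nu i a)) < dotp beta p.
  move=> a; have /existsNP[Q /not_implyP[dQ /negP]] := N a.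
  by rewrite -ltNge; exists Q.
have [|||||||a] := @finite_family_majorant R m 'I_K
    (conv_hull (Iprime nu r bt)) beta p _ _ _ _ _ _
    (fun a i => KL (Q a) (nu i a)) _.
- by exists beta, (Iprime nu r bt beta); exact: conv_hull_graph.
- by move=> u v; exact: conv_hull_simplex.
- by move=> *; exact: conv_hull_conv.
- exact: sb.2.
- by apply: conv_hull_le_dotp; exact/ShatP.
- move=> z zG; apply/pmin/ShatP => b b1.
  by apply: zG; exact: conv_hull_graph.
- by move=> u v; apply: conv_hull_Iprime_le => a; have [] := hQ a.
- by rewrite leNgt; have [_ ->] := hQ a.
Qed.

End Bandits.

(** * The projection inequality *)

Theorem mainTheorem14 (R : realType) (X : finType) (m K : nat)
  (nu : 'I_m -> 'I_K -> X -> R)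
  (hm : (2 <= m)%N) (hK : (0 < K)%N)
  (hnu_pos : forall i a x, 0 < nu i a x)
  (hnu_sum : forall i a, \sum_(x : X) nu i a x = 1)
  (r : R) (bt : 'I_m -> 'I_m -> R)
  (hbt : forall i j, inM nu r i j -> 0 <= bt i j <= 1)
  (hcond : forall lam : 'I_m -> 'I_m -> R,
     (forall i j, inM nu r i j -> 0 <= lam i j) ->
     \sum_(i < m) \sum_(j < m | `[< inM nu r i j >]) lam i j = 1 ->
     r <= Lmaxphi nu (fun k => \sum_(i < m) \sum_(j < m | `[< inM nu r i j >])
                              lam i j * beta_ij i j (bt i j) k)) :
  forall y p : 'I_m -> R,
    ~ Shat nu r bt y -> is_proj (Shat nu r bt) y p ->
    exists2 w, simplex K w &
      forall Q : 'I_K -> X -> R, (forall a, distr_on (Q a)) ->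
        dotp (fun k => y k - p k) (fun k => payoff nu w Q k - p k) <= 0.
Proof.
move=> y p Sy yp; have [Sp _] := yp.
have obtuse z : Shat nu r bt z ->
    dotp (fun k => y k - p k) (fun k => z k - p k) <= 0.
  by apply: is_proj_obtuse yp => t x1 x2; exact: Shat_conv.
(* [p + e_k] lies in [Shat], so the obtuse angle at [p] gives [y k <= p k]. *)
have py0 k : 0 <= p k - y k.
  have := obtuse _ (Shat_upward k Sp).
  under [X in dotp _ X]eq_fun do rewrite addrAC subrr add0r.
  by rewrite dotp_delta; lra.
(* Normaliser of [p - y]; if it vanished, [y = p] would lie in [Shat]. *)
pose s := \sum_k (p k - y k).
have s0 : 0 < s.
  rewrite lt_neqAle sumr_ge0 ?andbT//; apply/eqP => /esym/psumr_eq0P s0.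
  apply: Sy; suff -> : y = p by [].
  by apply/funext => k; have := s0 (fun k _ => py0 k) k isT; lra.
pose beta k := s^-1 * (p k - y k).
have sb : simplex m beta.
  split=> [k|]; first by rewrite mulr_ge0 ?py0// invr_ge0 ltW.
  by rewrite -mulr_sumr -/s mulVf ?gt_eqF.
(* Serves twice: [x] in [Shat] gives the minimality of [p], and [x] a payoff gives the goal. *)
have dotpE x : dotp (fun k => y k - p k) (fun k => x k - p k) =
    s * (dotp beta p - dotp beta x).
  rewrite /beta !dotpZl -mulrBr mulrA divff ?gt_eqF// mul1r.
  by rewrite !(dotpBl, dotpBr); ring.
have pmin z : Shat nu r bt z -> dotp beta p <= dotp beta z.
  by move=> /obtuse; rewrite dotpE pmulr_rle0// subr_le0.
have [a ha] := Shat_Bset_direction hnu_pos hnu_sum (ltnW hm) hK hbt hcond sb Sp pmin.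
exists (fun c => (c == a)%:R).
  split=> [c|]; first exact: ler0n.
  by rewrite (bigD1 a)//= eqxx big1 ?addr0// => c /negbTE ->.
move=> Q dQ; rewrite dotpE pmulr_rle0// subr_le0.
suff -> : payoff nu (fun c => (c == a)%:R) Q = (fun i => KL (Q a) (nu i a)).
  exact: ha.
apply/funext => i; rewrite /payoff (bigD1 a)//= eqxx mul1r big1 ?addr0//.
by move=> c /negbTE ->; rewrite mul0r.
Qed.
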